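(* Let $G$ be a finite group. Then the enhanced power graph $\mathcal{E}(G)$ is claw-free if and only if $G$ is cyclic.
   Context: For a finite group $G$, the enhanced power graph $\mathcal{E}(G)$ is the graph with vertex set $G$ in which two distinct vertices $u,v$ are adjacent if and only if there exists $w\in G$ with $u,v\in\langle w\rangle$, equivalently if and only if $\langle u,v\rangle$ is cyclic. A claw is a graph isomorphic to the complete bipartite graph $K_{1,3}$; a graph is claw-free if it contains no induced subgraph isomorphic to a claw. *)

(* Defs.v *)
From HB Require Import structures.
From mathcomp Require Import all_boot all_order all_fingroup all_solvable.

Set Implicit Arguments.
Unset Strict Implicit.
Unset Printing Implicit Defensive.

Record sgraph := SGraph {
  vertex :> finType;
  adj : rel vertex;
  adj_sym : symmetric adj;
  adj_irrefl : irreflexive adj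
}.

Definition sgraph_iso (X Y : sgraph) : Prop :=
  exists2 f : X -> Y, bijective f & {mono f : x y / adj x y}.

Section InducedSubgraph.

Variables (X : sgraph) (A : {set X}).

Definition induced_adj : rel {x : X | x \in A} :=
  fun x y => adj (val x) (val y).

Lemma induced_adj_sym : symmetric induced_adj.
Proof. by move=> x y; apply: adj_sym. Qed.

Lemma induced_adj_irrefl : irreflexive induced_adj.
Proof. by move=> x; apply: adj_irrefl. Qed.

Definition induced_subgraph : sgraph :=
  SGraph induced_adj_sym induced_adj_irrefl.

End InducedSubgraph.

Section CompleteBipartite.

Variables m n : nat.

Definition bipartite_adj : rel ('I_m + 'I_n)%type :=
  fun x y =>
    match x, y with
    | inl _, inr _ | inr _, inl _ => true
    | _, _ => false
    end.

Lemma bipartite_adj_sym : symmetric bipartite_adj.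
Proof. by case=> ? [?|?]. Qed.

Lemma bipartite_adj_irrefl : irreflexive bipartite_adj.
Proof. by case. Qed.

Definition complete_bipartite : sgraph :=
  SGraph bipartite_adj_sym bipartite_adj_irrefl.

End CompleteBipartite.

Definition is_claw (X : sgraph) : Prop := sgraph_iso X (complete_bipartite 1 3).

Definition claw_free (X : sgraph) : Prop :=
  ~ exists A : {set X}, is_claw (induced_subgraph A).

Section EnhancedPowerGraph.

Variables (gT : finGroupType) (G : {group gT}).

(* The vertex set is the group type [subg G] of elements of G, and the
   witness w ranges over G, not over the ambient type gT. *)
Definition enhanced_power_adj : rel [subg G] :=
  fun u v => (u != v) && [exists w : [subg G], (u \in <[w]>%g) && (v \in <[w]>%g)].

Lemma enhanced_power_adj_sym : symmetric enhanced_power_adj.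
Proof.
move=> u v; rewrite /enhanced_power_adj eq_sym; congr (_ && _).
by apply: eq_existsb => w; rewrite andbC.
Qed.

Lemma enhanced_power_adj_irrefl : irreflexive enhanced_power_adj.
Proof. by move=> u; rewrite /enhanced_power_adj eqxx. Qed.

Definition enhanced_power_graph : sgraph :=
  SGraph enhanced_power_adj_sym enhanced_power_adj_irrefl.

End EnhancedPowerGraph.

(* Main.v *)
(** A cyclic group has a complete enhanced power graph, in which two leaves of a
    claw would be adjacent. If [G] is not cyclic, take a generator [a] of a maximal
    cyclic subgroup and a generator [b] of a maximal cyclic subgroup containing an
    element outside [<[a]>]. Then [a * b] lies in neither [<[a]>] nor [<[b]>], so it
    lies in a third maximal cyclic subgroup, generated by some [c]. Generators of
    distinct maximal cyclic subgroups are not adjacent, while [1] is adjacent to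
    everything: [1; a, b, c] is a claw. *)
Require Import Defs.
From mathcomp Require Import all_boot all_order all_fingroup all_solvable.

Set Implicit Arguments.
Unset Strict Implicit.
Unset Printing Implicit Defensive.

Import GroupScope.

Lemma sgraph_iso_sym (X Y : sgraph) : sgraph_iso X Y -> sgraph_iso Y X.
Proof.
case=> f [g fK gK] f_mono; exists g; first by exists f.
by move=> x y; rewrite -f_mono !gK.
Qed.

Lemma induced_subgraph_of_embedding (X Y : sgraph) (f : X -> Y) :
  injective f -> {mono f : x y / adj x y} ->
  exists A : {set Y}, sgraph_iso X (induced_subgraph A).
Proof.
move=> f_inj f_mono; exists (f @: [set: X]).
have fA x : f x \in f @: [set: X] by rewrite imset_f.
exists (fun x => exist _ (f x) (fA x)); last exact: f_mono.
apply: inj_card_bij => [x y [] /f_inj //|].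
by rewrite card_sig card_imset // cardsT.
Qed.

(** Only the leaves need to be assumed distinct: irreflexivity already separates the centre [z] from
    its neighbours. *)
Lemma claw_in_graph (X : sgraph) (z a b c : X) :
  adj z a -> adj z b -> adj z c ->
  a != b -> a != c -> b != c ->
  ~~ adj a b -> ~~ adj a c -> ~~ adj b c -> ~ claw_free X.
Proof.
move=> za zb zc ab ac bc nab nac nbc; apply.
pose leaf (j : 'I_3) := tnth [tuple a; b; c] j.
pose f (v : complete_bipartite 1 3) := if v is inr j then leaf j else z.
have adj_neq u v : adj u v -> u != v :> X.
  by apply: contraTneq => ->; rewrite adj_irrefl.
have leaf_inj : injective leaf.
  apply/tuple_uniqP.
  by rewrite /= !inE negb_or ab ac bc.
have z_leaf j : adj z (leaf j) by case: j => [[|[|[|]]]].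
have leafN i j : ~~ adj (leaf i) (leaf j).
  case: i j => [[|[|[|//]]] ?] [[|[|[|//]]] ?];
    by rewrite /leaf !(tnth_nth z) /= ?adj_irrefl // adj_sym.
have f_inj : injective f.
  move=> [i|i] [j|j] //=; first by rewrite (ord1 i) (ord1 j).
  - by move=> zj; have := adj_neq _ _ (z_leaf j); rewrite -zj eqxx.
  - by move=> zi; have := adj_neq _ _ (z_leaf i); rewrite zi eqxx.
  - by move=> /leaf_inj ->.
have f_mono : {mono f : u v / adj u v}.
  move=> [i|i] [j|j] /=; first by rewrite adj_irrefl.
  - exact: z_leaf.
  - by rewrite adj_sym; apply: z_leaf.
  - exact/negbTE/leafN.
have [A isoA] := induced_subgraph_of_embedding f_inj f_mono.
by exists A; apply: sgraph_iso_sym.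
Qed.

Lemma complete_claw_free (X : sgraph) :
  (forall u v : X, u != v -> adj u v) -> claw_free X.
Proof.
move=> X_complete [A /sgraph_iso_sym [f [g fK _] f_mono]].
pose u : complete_bipartite 1 3 := inr ord0.
pose v : complete_bipartite 1 3 := inr ord_max.
have : ~~ adj (f u) (f v) by rewrite f_mono.
apply/negP/negPn/X_complete.
by rewrite (inj_eq val_inj) (can_eq fK).
Qed.

Section MaximalCyclic.

Variable hT : finGroupType.
Implicit Types a b w x : hT.

(** Maximality of [<[a]>] among cyclic subgroups, phrased on generators: [a \in <[w]>] is one
    inclusion, [w \in <[a]>] the reverse one. *)
Definition gen_max_cyclic a := forall w, a \in <[w]> -> w \in <[a]>.

(** Take [a] of largest order among the elements whose cyclic subgroup contains [x]. *)
Lemma gen_max_cyclic_exists x : exists2 a, x \in <[a]> & gen_max_cyclic a.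
Proof.
case: (@arg_maxnP _ x (fun a => x \in <[a]>) order (cycle_id x)) => a xa a_max.
exists a => // w aw.
have sub_aw : <[a]> \subset <[w]> by rewrite cycle_subG.
suff /eqP -> : <[a]> == <[w]> by apply: cycle_id.
by rewrite eqEcard sub_aw; apply: a_max; apply: (subsetP sub_aw).
Qed.

Lemma gen_max_cyclic_common a b w :
  gen_max_cyclic a -> gen_max_cyclic b ->
  a \in <[w]> -> b \in <[w]> -> <[a]> = <[b]>.
Proof.
have cycle_eq x : gen_max_cyclic x -> x \in <[w]> -> <[x]> = <[w]>.
  by move=> x_max xw; apply/eqP; rewrite eqEsubset !cycle_subG xw x_max.
by move=> a_max b_max /(cycle_eq _ a_max) -> /(cycle_eq _ b_max) ->.
Qed.

Lemma three_max_cyclic :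
  ~~ cyclic [set: hT] ->
  exists a b c,
    [/\ gen_max_cyclic a, gen_max_cyclic b & gen_max_cyclic c] /\
    [/\ <[a]> != <[b]>, <[a]> != <[c]> & <[b]> != <[c]>].
Proof.
(* Any maximal cyclic subgroup will do, so [1] is an arbitrary seed. *)
move=> ncyc; have [a _ a_max] := gen_max_cyclic_exists 1.
have [x xNa] : exists x, x \notin <[a]>.
  apply/existsP; apply: contraR ncyc => /existsPn a_all.
  apply/cyclicP; exists a; apply/esym/setP=> x; rewrite inE.
  exact/negPn/a_all.
have [b xb b_max] := gen_max_cyclic_exists x.
have ab_neq : <[a]> != <[b]> by apply: contraNneq xNa => ->.
have [c abc c_max] := gen_max_cyclic_exists (a * b).
(* If [<[c]>] were [<[a]>] or [<[b]>], cancelling in [a * b] would put [a] and [b] in one cyclic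
   subgroup, forcing [<[a]> = <[b]>]. *)
exists a, b, c; split=> //; split=> //; apply: contraNneq ab_neq => E.
- apply/eqP/(@gen_max_cyclic_common _ _ a) => //; first exact: cycle_id.
  by rewrite -E groupMl ?cycle_id // in abc.
- apply/eqP/(@gen_max_cyclic_common _ _ b) => //; last exact: cycle_id.
  by rewrite -E groupMr ?cycle_id // in abc.
Qed.

End MaximalCyclic.

Theorem theorem2p1 (gT : finGroupType) (G : {group gT}) :
  claw_free (enhanced_power_graph G) <-> cyclic G.
Proof.
rewrite (isog_cyclic (isog_subg G)); split=> [G_cf | /cyclicP [g Gg]]; last first.
  apply: complete_claw_free => u v uv.
  apply/andP; split=> //; apply/existsP; exists g.
  by rewrite -Gg !inE.
apply: contraT => /three_max_cyclic.
case=> a [b [c [[a_max b_max c_max] [ab ac bc]]]].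
have neq (x y : [subg G]) : <[x]> != <[y]> -> x != y by apply: contraNneq => ->.
have nadj (x y : [subg G]) : gen_max_cyclic x -> gen_max_cyclic y ->
    <[x]> != <[y]> -> ~~ enhanced_power_adj x y.
  move=> x_max y_max; apply: contraNN => /andP [_ /existsP [w /andP [xw yw]]].
  exact/eqP/(gen_max_cyclic_common x_max y_max xw yw).
(* The second subgroup [<[y]>] ensures [x != 1]: the identity lies in [<[y]>], so [x = 1] would give
   [<[x]> = <[y]>]. *)
have adj1 (x y : [subg G]) : gen_max_cyclic x -> gen_max_cyclic y ->
    <[x]> != <[y]> -> enhanced_power_adj 1 x.
  move=> x_max y_max xy; apply/andP; split; last first.
    by apply/existsP; exists x; rewrite group1 cycle_id.
  apply: contraNneq xy => x1; apply/eqP.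
  by apply: (gen_max_cyclic_common (w := y)) => //; rewrite -?x1 ?group1 ?cycle_id.
suff: ~ claw_free (enhanced_power_graph G) by move/(_ G_cf).
apply: (@claw_in_graph (enhanced_power_graph G) 1 a b c) => /=; auto.
- exact: adj1 ab.
- exact: adj1 bc.
- by apply: (adj1 _ a) => //; rewrite eq_sym.
Qed.
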